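(* Let $d\ge 2$ and $m$ be integers with $Z(d)\le m<2d$. Then $f_{\triangle}(d,m)=dm+\lfloor d/2\rfloor$.
   Context: All graphs are finite, simple and undirected. A graph is triangle-free if it has no three pairwise adjacent vertices. $\Delta(G)$ is the maximum degree and $\nu(G)$ the matching number of $G$. For positive integers $d,m$, $f_{\triangle}(d,m)$ is the maximum number of edges of a triangle-free graph $G$ with $\Delta(G)\le d$ and $\nu(G)\le m$. A graph $G$ is factor-critical if $G-v$ has a perfect matching for every vertex $v$. A graph is almost $d$-regular if one vertex has degree $d-1$ and all other vertices have degree $d$. For $d\ge 2$, $Z(d)$ is the smallest positive integer $n$ such that there exists a triangle-free factor-critical graph $G$ with $\nu(G)=n$ that is $d$-regular (if $d$ is even) or almost $d$-regular (if $d$ is odd). *)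

(* Defs.v *)
From mathcomp Require Import all_boot.

Set Implicit Arguments.
Unset Strict Implicit.
Unset Printing Implicit Defensive.

Record sgraph : Type := SGraph {
  vertex :> finType;
  adj : rel vertex;
  adj_sym : symmetric adj;
  adj_irr : irreflexive adj
}.

Section Graph.
Variable G : sgraph.

Definition edges : {set {set G}} :=
  [set [set p.1; p.2] | p : G * G & adj p.1 p.2].

Definition degree (v : G) : nat := #|[set w | adj v w]|.

Definition max_degree : nat := \max_(v : G) degree v.

Definition matching (M : {set {set G}}) : bool :=
  (M \subset edges) && trivIset M.

Definition matching_number : nat := \max_(M | matching M) #|M|.

Definition perfect_matching (M : {set {set G}}) : bool :=
  matching M && (cover M == [set: G]).

Definition triangle_free : Prop :=
  forall x y z : G, ~ [/\ adj x y, adj y z & adj x z].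

Definition regular (d : nat) : Prop := forall v : G, degree v = d.

(* Only used for [d >= 2], so the truncated predecessor is harmless. *)
Definition almost_regular (d : nat) : Prop :=
  exists2 v : G, degree v = d.-1 & forall w : G, w != v -> degree w = d.

End Graph.

Section Delete.
Variables (G : sgraph) (v : G).

Definition del_adj : rel {x : G | x != v} := fun x y => adj (val x) (val y).

Lemma del_adj_sym : symmetric del_adj.
Proof. by move=> x y; apply: adj_sym. Qed.

Lemma del_adj_irr : irreflexive del_adj.
Proof. by move=> x; apply: adj_irr. Qed.

Definition del_vertex : sgraph := SGraph del_adj_sym del_adj_irr.

End Delete.

Definition factor_critical (G : sgraph) : Prop :=
  forall v : G, exists M : {set {set del_vertex v}}, perfect_matching M.

Definition is_maximum (P : nat -> Prop) (n : nat) : Prop :=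
  P n /\ forall k, P k -> k <= n.

Definition is_minimum (P : nat -> Prop) (n : nat) : Prop :=
  P n /\ forall k, P k -> n <= k.

(* [is_f_triangle d m N] means that the maximum f_triangle(d, m) exists and
   equals [N]. *)
Definition is_f_triangle (d m : nat) : nat -> Prop :=
  is_maximum (fun N => exists G : sgraph,
    [/\ triangle_free G, max_degree G <= d, matching_number G <= m
      & #|edges G| = N]).

(* [is_Z d z] means that the minimum Z(d) exists and equals [z]. *)
Definition is_Z (d : nat) : nat -> Prop :=
  is_minimum (fun n => 0 < n /\ exists G : sgraph,
    [/\ triangle_free G, factor_critical G, matching_number G = n
      & if odd d then almost_regular G d else regular G d]).

(* Main.v *)
(** Upper bound: if some vertex is covered by every maximum matching, deleting
    it costs at most [d] edges and lowers the matching number.  Otherwise, by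
    Gallai's lemma, "no maximum matching misses both" is an equivalence relation
    on the vertices, and it contains adjacency.  A maximum matching misses at
    most one vertex of each class, so the halves [k] of the class sizes, rounded
    down, sum to the matching number [nu].  A class of size at most [2k + 1]
    spans at most [d k] edges by Mantel if [k < d], and at most [d k + d/2] by
    counting degrees otherwise.  The second case occurs at most [nu / d] times,
    hence at most once when [nu < 2d].  Lower bound: a graph witnessing
    [Z(d) = z] has [2z + 1] vertices and [d z + d/2] edges; add [m - z] disjoint
    stars [K_{1,d}]. *)

Require Import Defs.
From mathcomp Require Import all_boot.
From mathcomp Require Import zify.

Set Implicit Arguments.
Unset Strict Implicit.
Unset Printing Implicit Defensive.

Lemma sum_card_setI (T : finType) (P : {set {set T}}) (A : {set T}) :
  trivIset P -> \sum_(B in P) #|B :&: A| = #|cover P :&: A|.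
Proof.
move=> tP; rewrite -[RHS]sum1_card.
rewrite (eq_bigl (fun x => (x \in cover P) && (x \in A))) => [|x].
  rewrite big_trivIset_cond //; apply: eq_bigr => B _.
  by rewrite -sum1_card; apply: eq_bigl => x; rewrite inE.
by rewrite inE.
Qed.

Lemma imset_preimset (T U : finType) (h : T -> U) (A : {set U}) :
  A \subset codom h -> h @: (h @^-1: A) = A.
Proof.
move/subsetP=> Ah; apply/setP => y; apply/imsetP/idP => [[x]|yA].
  by rewrite inE => xA ->.
by have /codomP[x yx] := Ah _ yA; exists x; rewrite // inE -yx.
Qed.

Lemma card_preimset_imset (T U : finType) (h : T -> U) (P : {set {set U}}) :
  injective h ->
  #|[set A : {set T} | h @: A \in P]| = #|[set B in P | B \subset codom h]|.
Proof.
move=> h_inj; rewrite -(card_imset _ (imset_inj h_inj)); apply: eq_card => B.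
rewrite inE; apply/imsetP/andP => [[A]|[BP Bh]]; last first.
  by exists (h @^-1: B); rewrite ?inE imset_preimset.
rewrite inE => AP ->; split=> //.
by apply/subsetP => _ /imsetP[x _ ->]; apply: codom_f.
Qed.

Section Edges.
Variable G : sgraph.
Implicit Types (v w x y : G) (e : {set G}) (B : {set G}).

Lemma edgesP e :
  reflect (exists x y, adj x y /\ e = [set x; y]) (e \in edges G).
Proof.
apply: (iffP imsetP) => [[[x y]]|[x [y [xy ->]]]].
  by rewrite inE /= => xy ->; exists x, y.
by exists (x, y); rewrite ?inE.
Qed.

Lemma adj_neq x y : adj x y -> x != y.
Proof. by apply: contraTneq => ->; rewrite adj_irr. Qed.

Lemma card_edge e : e \in edges G -> #|e| = 2.
Proof. by case/edgesP=> x [y [xy ->]]; rewrite cards2 adj_neq. Qed.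

Lemma edge_incidentP e v :
  e \in edges G -> v \in e -> exists2 w, adj v w & e = [set v; w].
Proof.
case/edgesP=> x [y [xy ->]]; rewrite !inE => /orP[] /eqP->; first by exists y.
by exists x; rewrite 1?adj_sym // setUC.
Qed.

Lemma mem_edges x y : ([set x; y] \in edges G) = adj x y.
Proof.
apply/idP/idP => [xyE|xy]; last by apply/edgesP; exists x, y.
have [w xw eq_xy_xw] := edge_incidentP xyE (set21 x y).
have: w \in [set x; y] by rewrite eq_xy_xw set22.
by rewrite !inE eq_sym (negPf (adj_neq xw)) => /eqP <-.
Qed.

Lemma degree_edges v : degree v = #|[set e in edges G | v \in e]|.
Proof.
have -> : [set e in edges G | v \in e] =
          [set [set v; w] | w in [set w | adj v w]].
  apply/setP=> e; rewrite !inE; apply/andP/imsetP => [[eG ve]|[w]].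
    by have [w vw ->] := edge_incidentP eG ve; exists w; rewrite ?inE.
  by rewrite inE => vw ->; rewrite mem_edges !inE eqxx.
rewrite card_in_imset // => a b; rewrite !inE => va _ /setP/(_ a).
by rewrite !inE eqxx orbT [a == v]eq_sym (negPf (adj_neq va)) => /esym/eqP.
Qed.

Lemma sum_degree B : \sum_(v in B) degree v = \sum_(e in edges G) #|B :&: e|.
Proof.
under eq_bigr do rewrite degree_edges -sum1dep_card.
rewrite (exchange_big_dep [in edges G]) => [|v e _ /andP[] //] /=.
apply: eq_bigr => e eG; rewrite -sum1_card; apply: eq_bigl => v.
by rewrite !inE eG.
Qed.

Lemma handshake : \sum_(v : G) degree v = 2 * #|edges G|.
Proof.
rewrite (eq_bigl [in [set: G]]) => [|v]; last by rewrite !inE.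
rewrite sum_degree mulnC -sum_nat_const; apply: eq_bigr => e eG.
by rewrite setTI card_edge.
Qed.

Lemma leq_degree_max v : degree v <= max_degree G.
Proof. exact: leq_bigmax. Qed.

Lemma leq_card_edges_degree : 2 * #|edges G| <= #|G| * max_degree G.
Proof.
rewrite -handshake -sum_nat_const; apply: leq_sum => v _.
exact: leq_degree_max.
Qed.

Definition vertex_cover B := forall x y, adj x y -> (x \in B) || (y \in B).

Lemma vertex_cover_edge B e :
  vertex_cover B -> e \in edges G -> 0 < #|B :&: e|.
Proof.
move=> covB /edgesP[x [y [xy ->]]]; apply/card_gt0P.
by case/orP: (covB _ _ xy) => [xB|yB]; [exists x|exists y];
   rewrite !inE eqxx ?orbT andbT.
Qed.

Lemma leq_card_edges_vertex_cover B :
  vertex_cover B -> #|edges G| <= \sum_(v in B) degree v.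
Proof.
move=> covB; rewrite sum_degree -sum1_card; apply: leq_sum => e.
exact: vertex_cover_edge.
Qed.

End Edges.

Section Matchings.
Variable G : sgraph.
Implicit Types (v x y z : G) (e f B C : {set G}) (M N : {set {set G}}).

Lemma matching_edge M e : matching M -> e \in M -> e \in edges G.
Proof. by case/andP=> /subsetP ME _ /ME. Qed.

Lemma matching0 : matching (set0 : {set {set G}}).
Proof. by rewrite /matching sub0set; apply/trivIsetP => A B; rewrite inE. Qed.

Lemma matchingS M N : N \subset M -> matching M -> matching N.
Proof.
move=> NM /andP[ME tM].
by rewrite /matching (subset_trans NM) // (trivIsetS NM).
Qed.

Lemma matchingU1 M e :
  matching M -> e \in edges G -> [disjoint e & cover M] ->
  matching (e |: M) /\ e \notin M.
Proof.
move=> mM eG eM; have /andP[ME tM] := mM.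
have nM0 : set0 \notin M.
  by apply/negP => /(matching_edge mM)/card_edge; rewrite cards0.
have [|tU ->] := trivIsetU1 _ tM nM0 (A := e).
  by move=> f fM; apply: disjointWr eM; apply: bigcup_sup.
by rewrite /matching tU subUset sub1set eG ME.
Qed.

Lemma cover_incidentP M v :
  matching M -> v \in cover M -> exists2 w, adj v w & [set v; w] \in M.
Proof.
move=> mM /bigcupP[e eM ve].
have [w vw ew] := edge_incidentP (matching_edge mM eM) ve.
by exists w; rewrite -?ew.
Qed.

Lemma card_cover_matching M : matching M -> #|cover M| = 2 * #|M|.
Proof.
move=> mM; have /andP[_ /eqP <-] := mM; rewrite mulnC -sum_nat_const.
by apply: eq_bigr => e /(matching_edge mM)/card_edge.
Qed.

Lemma leq_matching_number M : matching M -> #|M| <= matching_number G.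
Proof. exact: leq_bigmax_cond. Qed.

Lemma leq_matching_number_vertex_cover B :
  vertex_cover B -> matching_number G <= #|B|.
Proof.
move=> covB; apply/bigmax_leqP => M mM; have /andP[_ tM] := mM.
apply: leq_trans (subset_leq_card (subsetIr (cover M) B)).
rewrite -sum_card_setI // -sum1_card; apply: leq_sum => e eM.
by rewrite setIC vertex_cover_edge // (matching_edge mM).
Qed.

(* A matching restricted to [C] covers exactly the vertices of [C] that the
   whole matching covers. *)
Lemma even_closed_cover C M :
  closed (@adj G) C -> matching M -> ~~ odd #|C :&: cover M|.
Proof.
move=> clC mM.
have subM : M ::&: C \subset M by rewrite -setI_powerset subsetIl.
suff -> : C :&: cover M = cover (M ::&: C).
  by rewrite (card_cover_matching (matchingS subM mM)) mul2n odd_double.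
apply/setP => x; rewrite inE; apply/andP/bigcupP => [[xC xM]|[e]].
  have [y xy xyM] := cover_incidentP mM xM.
  exists [set x; y]; last exact: set21.
  by rewrite inE xyM subUset !sub1set -(clC _ _ xy) xC.
rewrite inE => /andP[eM /subsetP eC] xe; split; first exact: eC.
by apply/bigcupP; exists e.
Qed.

Definition max_matching M := matching M && (#|M| == matching_number G).

Lemma max_matching_exists : exists M, max_matching M.
Proof.
have [|M mM eM] := @eq_bigmax_cond _ (@matching G) (fun M => #|M|).
  by apply/card_gt0P; exists set0; exact: matching0.
exists M; apply/andP; split; first exact: mM.
by rewrite -eM /matching_number; apply/eqP/eq_bigl.
Qed.

Lemma leq_double_matching_number : 2 * matching_number G <= #|G|.
Proof.
have [M /andP[mM /eqP <-]] := max_matching_exists.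
by rewrite -card_cover_matching // max_card.
Qed.

Lemma max_matching_adj M x y :
  max_matching M -> adj x y -> x \notin cover M -> y \in cover M.
Proof.
case/andP=> mM /eqP nM xy xM; apply: contraT => yM.
have [||mM' eM] := matchingU1 mM (e := [set x; y]).
- by rewrite mem_edges.
- by rewrite disjoints_subset subUset !sub1set !inE xM.
by have := leq_matching_number mM'; rewrite cardsU1 eM nM ltnn.
Qed.

Lemma card_cover_setD M N :
  max_matching M -> max_matching N ->
  #|cover M :\: cover N| = #|cover N :\: cover M|.
Proof.
case/andP=> mM /eqP cM /andP[mN /eqP cN]; apply/(@addnI #|cover M :&: cover N|).
by rewrite cardsID setIC cardsID !card_cover_matching // cM cN.
Qed.

Lemma max_matching_swap M y z f :
  max_matching M -> adj y z -> y \notin cover M -> f \in M -> z \in f ->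
  max_matching ([set y; z] |: (M :\ f)).
Proof.
case/andP=> mM cM yz yM fM zf; have mMf := matchingS (subsetDl M [set f]) mM.
have [||mM' eM] := matchingU1 mMf (e := [set y; z]).
- by rewrite mem_edges.
- have /andP[_ tM] := mM.
  rewrite disjoints_subset subUset !sub1set coverD1 // !inE zf.
  by rewrite (negPf yM) andbF.
by rewrite /max_matching mM' cardsU1 eM -(eqP cM) (cardsD1 f M) fM eqxx.
Qed.

Definition inessential v := [exists M, max_matching M && (v \notin cover M)].

Lemma inessentialP v :
  reflect (exists2 M, max_matching M & v \notin cover M) (inessential v).
Proof.
by apply: (iffP existsP) => [[M /andP[maxM vM]]|[M maxM vM]];
   exists M; rewrite ?maxM.
Qed.

End Matchings.

Section InducedEmbedding.
Variables (G H : sgraph) (h : G -> H).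
Hypotheses (h_inj : injective h) (h_mono : {mono h : x y / adj x y}).
Implicit Types (x y : G) (e : {set G}).

Lemma triangle_free_embedding : triangle_free H -> triangle_free G.
Proof.
by move=> tf x y z xyz; case: (tf (h x) (h y) (h z)); rewrite !h_mono.
Qed.

Lemma leq_degree_embedding x : degree x <= degree (h x).
Proof.
rewrite /degree -(card_imset _ h_inj); apply/subset_leq_card/subsetP => w.
by case/imsetP=> y + ->; rewrite !inE h_mono.
Qed.

Lemma degree_closed_embedding x :
  closed (@adj H) (codom h) -> degree (h x) = degree x.
Proof.
move=> clh; apply/eqP; rewrite eqn_leq leq_degree_embedding andbT /degree.
rewrite -[leqRHS](card_imset _ h_inj); apply/subset_leq_card/subsetP => w.
rewrite inE => xw; have: w \in codom h by rewrite -(clh _ _ xw) codom_f.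
by case/codomP=> y wy; rewrite wy imset_f // inE -h_mono -wy.
Qed.

Lemma leq_max_degree_embedding : max_degree G <= max_degree H.
Proof.
apply/bigmax_leqP => x _.
exact: leq_trans (leq_degree_embedding x) (leq_degree_max _).
Qed.

Lemma mem_edges_embedding e : (h @: e \in edges H) = (e \in edges G).
Proof.
have [[x [y [_ ->]]]|not2] := altP (@cards2P _ e).
  by rewrite imsetU1 imset_set1 !mem_edges h_mono.
apply/idP/idP => /card_edge; rewrite ?card_imset // => e2;
  by rewrite e2 in not2.
Qed.

Lemma card_edges_embedding :
  #|edges G| = #|[set f in edges H | f \subset codom h]|.
Proof.
rewrite -card_preimset_imset //; apply: eq_card => e.
by rewrite inE mem_edges_embedding.
Qed.

Lemma matching_embedding (M : {set {set G}}) :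
  matching M -> matching [set h @: e | e : {set G} in M].
Proof.
move=> mM; have /andP[_ tM] := mM; rewrite /matching imset_trivIset // tM andbT.
apply/subsetP => _ /imsetP[e eM ->].
by rewrite mem_edges_embedding (matching_edge mM).
Qed.

Lemma leq_matching_number_embedding : matching_number G <= matching_number H.
Proof.
apply/bigmax_leqP => M mM; rewrite -(card_imset _ (imset_inj h_inj)).
exact/leq_matching_number/matching_embedding.
Qed.

Lemma leq_card_matching_codom (M : {set {set H}}) :
  matching M -> #|[set f in M | f \subset codom h]| <= matching_number G.
Proof.
move=> mM; have /andP[_ tM] := mM; rewrite -card_preimset_imset //.
apply/leq_matching_number/andP; split.
  apply/subsetP => e; rewrite inE => /(matching_edge mM).
  by rewrite mem_edges_embedding.
rewrite -(imset_trivIset _ h_inj); apply: trivIsetS tM.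
by apply/subsetP => _ /imsetP[e + ->]; rewrite inE.
Qed.

End InducedEmbedding.

Section InducedSubgraph.
Variables (G : sgraph) (A : {set G}).

Definition induced_adj : rel {x | x \in A} := fun x y => adj (val x) (val y).

Lemma induced_adj_sym : symmetric induced_adj.
Proof. by move=> x y; apply: adj_sym. Qed.

Lemma induced_adj_irr : irreflexive induced_adj.
Proof. by move=> x; apply: adj_irr. Qed.

Definition induced : sgraph := SGraph induced_adj_sym induced_adj_irr.

Lemma card_induced : #|induced| = #|A|.
Proof. exact: card_sig. Qed.

Definition induced_val : induced -> G := val.

Lemma induced_val_inj : injective induced_val.
Proof. exact: val_inj. Qed.

Lemma induced_val_mono : {mono induced_val : x y / adj x y}.
Proof. by []. Qed.

Lemma codom_induced : codom induced_val =i A.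
Proof.
move=> x; apply/codomP/idP => [[y ->]|xA]; first exact: (valP y).
by exists (exist _ x xA).
Qed.

Lemma degree_induced (x : induced) :
  closed (@adj G) A -> degree x = degree (val x).
Proof.
move=> clA.
rewrite (degree_closed_embedding induced_val_inj induced_val_mono) //.
by move=> y z yz; rewrite !codom_induced (clA _ _ yz).
Qed.

Lemma triangle_free_induced : triangle_free G -> triangle_free induced.
Proof. exact: triangle_free_embedding induced_val_mono. Qed.

Lemma leq_max_degree_induced : max_degree induced <= max_degree G.
Proof. exact: leq_max_degree_embedding induced_val_inj induced_val_mono. Qed.

End InducedSubgraph.

Lemma card_edges_closed_partition (G : sgraph) (P : {set {set G}}) :
  partition P [set: G] -> {in P, forall C : {set G}, closed (@adj G) C} ->
  #|edges G| = \sum_(C in P) #|edges (induced C)|.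
Proof.
move=> partP clP; apply/eqP; rewrite -(eqn_pmul2l (isT : 0 < 2)) -handshake.
rewrite (eq_bigl [in [set: G]]) => [|v]; last by rewrite !inE.
rewrite (set_partition_big _ partP) big_distrr; apply/eqP/eq_bigr => C CP /=.
rewrite -(handshake (induced C)) big_sub; apply: eq_bigr => x _.
by rewrite degree_induced //; apply: clP.
Qed.

Section VertexDeletion.
Variables (G : sgraph) (v : G).

Definition del_val : del_vertex v -> G := val.

Lemma del_val_inj : injective del_val.
Proof. exact: val_inj. Qed.

Lemma del_val_mono : {mono del_val : x y / adj x y}.
Proof. by []. Qed.

Lemma card_del_vertex : #|G| = #|del_vertex v|.+1.
Proof.
have -> : #|del_vertex v| = #|predC1 v| by apply: card_sig.
by rewrite cardC1 prednK //; apply/card_gt0P; exists v.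
Qed.

Lemma codom_del_vertex x : (x \in codom del_val) = (x != v).
Proof.
apply/codomP/idP => [[y ->]|xv]; first exact: (valP y).
by exists (exist _ x xv).
Qed.

Lemma card_edges_del_vertex : #|edges G| = #|edges (del_vertex v)| + degree v.
Proof.
rewrite (card_edges_embedding del_val_inj del_val_mono) degree_edges addnC.
rewrite -(cardsID [set e : {set G} | v \in e] (edges G)); congr (_ + _).
  by apply: eq_card => e; rewrite !inE.
apply: eq_card => e; rewrite !inE andbC; congr (_ && _).
apply/idP/subsetP => [ve x xe|ev].
  by rewrite codom_del_vertex; apply: contraNneq ve => <-.
by apply/negP => /ev; rewrite codom_del_vertex eqxx.
Qed.

Lemma triangle_free_del_vertex :
  triangle_free G -> triangle_free (del_vertex v).
Proof. exact: triangle_free_embedding del_val_mono. Qed.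

Lemma leq_max_degree_del_vertex : max_degree (del_vertex v) <= max_degree G.
Proof. exact: leq_max_degree_embedding del_val_inj del_val_mono. Qed.

Lemma leq_matching_number_del_vertex :
  matching_number (del_vertex v) <= matching_number G.
Proof. exact: leq_matching_number_embedding del_val_inj del_val_mono. Qed.

Lemma ltn_matching_number_del_essential :
  ~~ inessential v -> matching_number (del_vertex v) < matching_number G.
Proof.
rewrite ltnNge; apply: contra => nu_le; apply/inessentialP.
have [M /andP[mM /eqP cM]] := max_matching_exists (del_vertex v).
exists [set del_val @: e | e : {set del_vertex v} in M].
  rewrite /max_matching (matching_embedding del_val_inj del_val_mono mM).
  rewrite (card_imset _ (imset_inj del_val_inj)) cM eqn_leq nu_le andbT.
  exact: leq_matching_number_del_vertex.
rewrite cover_imset; apply/negP => /bigcupP[e _ /imsetP[x _ vx]].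
by have := valP x; rewrite /= -[val x]vx eqxx.
Qed.

End VertexDeletion.

(* The neighbourhood of a vertex of maximum degree is independent, so its
   complement is a vertex cover. *)
Lemma mantel (G : sgraph) : triangle_free G -> 4 * #|edges G| <= #|G| ^ 2.
Proof.
move=> tf; have [G0|Ggt0] := posnP #|G|.
  by have := leq_card_edges_degree G; rewrite G0 leqn0 muln_eq0 => /eqP ->.
pose D := max_degree G.
have [x degx] : {x : G | D = degree x} by exact: eq_bigmax.
pose B := ~: [set y | adj x y].
have covB : vertex_cover B.
  move=> y z yz; rewrite !inE -negb_and; apply/negP => /andP[xy xz].
  exact: (tf x y z).
have edges_le : #|edges G| <= #|B| * D.
  rewrite (leq_trans (leq_card_edges_vertex_cover covB)) // -sum_nat_const.
  by apply: leq_sum => y _; apply: leq_degree_max.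
have cardG : #|B| + D = #|G| by rewrite degx addnC cardsC.
by rewrite -cardG (leq_trans _ (nat_AGM2 _ _)) // leq_pmul2l.
Qed.

Definition edge_bound (d k : nat) : nat := d * k + d %/ 2 * (k %/ d).

Lemma edge_bound_superadditive d j k :
  edge_bound d j + edge_bound d k <= edge_bound d (j + k).
Proof.
rewrite /edge_bound addnACA mulnDr leq_add2l -mulnDr leq_mul2l.
have [->|d0] := posnP d; first by rewrite !divn0.
by rewrite divnD // leq_addr orbT.
Qed.

Lemma leq_edge_bound d j k : j <= k -> edge_bound d j <= edge_bound d k.
Proof.
move=> /subnKC <-; apply: leq_trans (edge_bound_superadditive d _ _).
exact: leq_addr.
Qed.

Lemma leq_sum_edge_bound d (I : finType) (P : pred I) (k : I -> nat) :
  \sum_(i | P i) edge_bound d (k i) <= edge_bound d (\sum_(i | P i) k i).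
Proof.
elim/big_rec2: _ => // i m n _ /(leq_add (leqnn (edge_bound d (k i)))) le_mn.
exact: leq_trans le_mn (edge_bound_superadditive _ _ _).
Qed.

Lemma leq_edge_bound_small d m : m < 2 * d -> edge_bound d m <= d * m + d %/ 2.
Proof.
move=> lt_m_2d; rewrite /edge_bound leq_add2l -[leqRHS]muln1 leq_mul2l.
by rewrite -ltnS ltn_divLR ?lt_m_2d ?orbT //; case: (d) lt_m_2d.
Qed.

Lemma leq_card_edges_order (G : sgraph) (d : nat) :
  triangle_free G -> max_degree G <= d ->
  #|edges G| <= edge_bound d (#|G| %/ 2).
Proof.
move=> tf Dd; have le_sq := mantel tf.
have le_deg : 2 * #|edges G| <= #|G| * d.
  by rewrite (leq_trans (leq_card_edges_degree G)) // leq_mul2l Dd orbT.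
move: {tf Dd} #|edges G| #|G| le_sq le_deg => E n le_sq le_deg.
rewrite /edge_bound; have [lt_kd|le_dk] := ltnP (n %/ 2) d.
  have le_n : n <= (2 * (n %/ 2)).+1 by lia.
  move: (n %/ 2) le_n lt_kd => k le_n lt_kd.
  have le_E : E <= k * k.+1.
    by move: le_sq (leq_mul le_n le_n); rewrite mulnn; nia.
  by rewrite (divn_small lt_kd) muln0 addn0 mulnC (leq_trans le_E) // leq_mul.
have le_E : E <= d * (n %/ 2) + d %/ 2 by nia.
rewrite (leq_trans le_E) // leq_add2l; have [->//|d0] := posnP d.
by rewrite leq_pmulr // divn_gt0.
Qed.

Section Gallai.
Variable G : sgraph.
Implicit Types (u v w x y z : G) (M N : {set {set G}}) (C : {set G}).

Lemma max_matching_closer M N w y :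
  max_matching M -> max_matching N -> w \notin cover N ->
  y \in cover M -> y \notin cover N -> y != w ->
  exists N', [/\ max_matching N', w \notin cover N' & #|M :&: N| < #|M :&: N'|].
Proof.
move=> /andP[mM _] maxN wN yM yN yw; have [z yz yzM] := cover_incidentP mM yM.
have yzN : [set y; z] \notin N.
  by apply: contra yN => yzN; apply/bigcupP; exists [set y; z]; rewrite ?set21.
have zN := max_matching_adj maxN yz yN; have /bigcupP[f fN zf] := zN.
have fM : f \notin M.
  have /andP[_ tM] := mM; apply: contra yzN => fM.
  by rewrite -(def_pblock tM yzM (set22 y z)) (def_pblock tM fM zf).
exists ([set y; z] |: (N :\ f)); split.
- exact: max_matching_swap maxN yz yN fN zf.
- apply: contra wN => /bigcupP[e /setU1P[->|/setD1P[_ eN] we]].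
    by rewrite !inE eq_sym (negPf yw) => /eqP ->.
  by apply/bigcupP; exists e.
- apply/proper_card/properP; split.
    apply/subsetP => e; rewrite !inE => /andP[eM eN]; rewrite eM eN andbT.
    by rewrite (contraNneq _ fM) ?orbT // => <-.
  by exists [set y; z]; rewrite !inE ?eqxx yzM.
Qed.

(* Among the maximum matchings missing [w], take one sharing most edges with
   [M]. *)
Lemma max_matching_near M w :
  max_matching M -> inessential w ->
  exists N, [/\ max_matching N, w \notin cover N
               & cover M :\: cover N \subset [set w]].
Proof.
move=> maxM /existsP[N0 N0P].
have [N /andP[maxN wN] Nbest] := @arg_maxnP _ N0
  (fun N => max_matching N && (w \notin cover N)) (fun N => #|M :&: N|) N0P.
exists N; split=> //; apply/subsetP => y /setDP[yM yN]; rewrite inE.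
apply: contraT => yw.
have [N' [maxN' wN']] := max_matching_closer maxM maxN wN yM yN yw.
by rewrite ltnNge => /negP[]; apply: Nbest; rewrite maxN'.
Qed.

Definition gallai_rel u v :=
  [forall M, [&& max_matching M, u \notin cover M & v \notin cover M]
             ==> (u == v)].

Lemma gallai_relP u v :
  reflect (forall M, max_matching M ->
             u \notin cover M -> v \notin cover M -> u = v)
          (gallai_rel u v).
Proof.
apply: (iffP forallP) => [uv M maxM uM vM|uv M].
  by apply/eqP/(implyP (uv M)); rewrite maxM uM.
by apply/implyP => /and3P[maxM uM vM]; apply/eqP/(uv M).
Qed.

Lemma gallai_rel_refl : reflexive gallai_rel.
Proof. by move=> u; apply/gallai_relP. Qed.

Lemma gallai_rel_sym : symmetric gallai_rel.
Proof.
move=> u v; apply: eq_forallb => M.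
by rewrite eq_sym [(u \notin _) && _]andbC.
Qed.

Lemma adj_gallai_rel u v : adj u v -> gallai_rel u v.
Proof.
by move=> uv; apply/gallai_relP => M maxM /(max_matching_adj maxM uv) ->.
Qed.

Lemma gallai_rel_trans u w v :
  inessential w -> gallai_rel w u -> gallai_rel w v -> gallai_rel u v.
Proof.
move=> iw /gallai_relP wu /gallai_relP wv; apply/gallai_relP => M maxM uM vM.
have [wM|wM] := boolP (w \in cover M); last first.
  by rewrite -(wu M maxM wM uM) (wv M maxM wM vM).
have [N [maxN wN near]] := max_matching_near maxM iw.
have uN : u \in cover N :\: cover M.
  by rewrite inE uM; apply: contraLR wM => /(wu N maxN wN) ->.
have vN : v \in cover N :\: cover M.
  by rewrite inE vM; apply: contraLR wM => /(wv N maxN wN) ->.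
have : #|cover N :\: cover M| <= 1.
  by rewrite (card_cover_setD maxN maxM) -(cards1 w) subset_leq_card.
by move/card_le1_eqP; apply.
Qed.

Definition gallai_classes := equivalence_partition gallai_rel [set: G].

Hypothesis all_inessential : forall v, inessential v.

Lemma gallai_equivalence : {in [set: G] & &, equivalence_rel gallai_rel}.
Proof.
move=> x y z _ _ _; split=> [|xy]; first exact: gallai_rel_refl.
apply/idP/idP => [|yz]; first exact: gallai_rel_trans.
by apply: gallai_rel_trans yz => //; rewrite gallai_rel_sym.
Qed.

Lemma gallai_classes_partition : partition gallai_classes [set: G].
Proof. exact/equivalence_partitionP/gallai_equivalence. Qed.

Lemma mem_gallai_class C x y :
  C \in gallai_classes -> x \in C -> (y \in C) = gallai_rel x y.
Proof.
move=> CP xC; have /and3P[_ tP _] := gallai_classes_partition.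
rewrite -(def_pblock tP CP xC).
by rewrite pblock_equivalence_partition ?inE //; apply: gallai_equivalence.
Qed.

Lemma gallai_class_closed C : C \in gallai_classes -> closed (@adj G) C.
Proof.
move=> CP; apply: intro_closed => [|x y xy xC].
  by apply: sym_connect_sym; apply: adj_sym.
by rewrite (mem_gallai_class y CP xC) adj_gallai_rel.
Qed.

Lemma leq_card_gallai_class_missed C M :
  C \in gallai_classes -> max_matching M -> #|C :\: cover M| <= 1.
Proof.
move=> CP maxM; apply/card_le1_eqP => x y /setDP[xC xM] /setDP[yC yM].
have /gallai_relP xy : gallai_rel x y by rewrite -(mem_gallai_class y CP xC).
exact/esym/(xy M).
Qed.

Lemma card_gallai_class_cover C M :
  C \in gallai_classes -> max_matching M -> #|C :&: cover M| = 2 * (#|C| %/ 2).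
Proof.
move=> CP maxM; have [mM _] := andP maxM.
have even_covered := even_closed_cover (gallai_class_closed CP) mM.
have le_missed := leq_card_gallai_class_missed CP maxM.
rewrite -(cardsID (cover M) C); move: even_covered le_missed.
by move: #|_ :&: _| #|_ :\: _| => covered missed; lia.
Qed.

Lemma sum_half_gallai_classes :
  \sum_(C in gallai_classes) #|C| %/ 2 = matching_number G.
Proof.
have [M maxM] := max_matching_exists G; have [mM /eqP cM] := andP maxM.
have card_cover : #|cover M| = \sum_(C in gallai_classes) #|C :&: cover M|.
  have /and3P[/eqP covG tG _] := gallai_classes_partition.
  by rewrite sum_card_setI // covG setTI.
apply/eqP; rewrite -(eqn_pmul2l (isT : 0 < 2)) -cM -card_cover_matching //.
rewrite card_cover big_distrr; apply/eqP/eq_bigr => C CP /=.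
by rewrite card_gallai_class_cover.
Qed.

End Gallai.

Lemma leq_card_edges_inessential (G : sgraph) (d : nat) :
  triangle_free G -> max_degree G <= d -> (forall v : G, inessential v) ->
  #|edges G| <= edge_bound d (matching_number G).
Proof.
move=> tf Dd iG; have partG := gallai_classes_partition iG.
rewrite (card_edges_closed_partition partG) => [|C]; last first.
  exact: gallai_class_closed.
rewrite -(sum_half_gallai_classes iG).
apply: leq_trans (leq_sum_edge_bound _ _ _); apply: leq_sum => C _.
rewrite -(card_induced C) leq_card_edges_order //.
  exact: triangle_free_induced.
exact: leq_trans (leq_max_degree_induced C) Dd.
Qed.

Lemma leq_card_edges_triangle_free (G : sgraph) (d : nat) :
  triangle_free G -> max_degree G <= d ->
  #|edges G| <= edge_bound d (matching_number G).
Proof.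
have [n] := ubnP (matching_number G); elim: n G => // n IHn G ltGn tf Dd.
have [/forallP|] := boolP [forall v : G, inessential v].
  exact: leq_card_edges_inessential.
rewrite negb_forall => /existsP[v /ltn_matching_number_del_essential lt_nu].
have le_rest :
    #|edges (del_vertex v)| <= edge_bound d (matching_number (del_vertex v)).
  apply: IHn; first exact: leq_trans lt_nu _.
    exact: triangle_free_del_vertex.
  exact: leq_trans (leq_max_degree_del_vertex v) Dd.
have le_deg : degree v <= edge_bound d 1.
  rewrite (leq_trans (leq_degree_max v)) // (leq_trans Dd) //.
  by rewrite /edge_bound muln1 leq_addr.
rewrite (card_edges_del_vertex v) (leq_trans (leq_add le_rest le_deg)) //.
by rewrite (leq_trans (edge_bound_superadditive _ _ _)) // addn1 leq_edge_bound.
Qed.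

Section GraphSum.
Variables G H : sgraph.

Definition sum_adj : rel (G + H) := fun a b =>
  match a, b with
  | inl x, inl y => adj x y
  | inr x, inr y => adj x y
  | _, _ => false
  end.

Lemma sum_adj_sym : symmetric sum_adj.
Proof. by move=> [x|x] [y|y] //=; apply: adj_sym. Qed.

Lemma sum_adj_irr : irreflexive sum_adj.
Proof. by move=> [x|x] /=; apply: adj_irr. Qed.

Definition graph_sum : sgraph := SGraph sum_adj_sym sum_adj_irr.

Definition sum_inl : G -> graph_sum := inl.
Definition sum_inr : H -> graph_sum := inr.

Lemma sum_inl_inj : injective sum_inl. Proof. by move=> x y []. Qed.
Lemma sum_inr_inj : injective sum_inr. Proof. by move=> x y []. Qed.

Lemma sum_inl_mono : {mono sum_inl : x y / adj x y}. Proof. by []. Qed.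
Lemma sum_inr_mono : {mono sum_inr : x y / adj x y}. Proof. by []. Qed.

Lemma codom_sum_inl a :
  (a \in codom sum_inl) = if a is inl _ then true else false.
Proof. by case: a => x; [rewrite codom_f|apply/codomP => -[]]. Qed.

Lemma codom_sum_inr a :
  (a \in codom sum_inr) = if a is inr _ then true else false.
Proof. by case: a => x; [apply/codomP => -[]|rewrite codom_f]. Qed.

Lemma degree_sum_inl x : degree (sum_inl x) = degree x.
Proof.
rewrite (degree_closed_embedding sum_inl_inj sum_inl_mono) //.
by move=> [a|a] [b|b] //; rewrite !codom_sum_inl.
Qed.

Lemma degree_sum_inr x : degree (sum_inr x) = degree x.
Proof.
rewrite (degree_closed_embedding sum_inr_inj sum_inr_mono) //.
by move=> [a|a] [b|b] //; rewrite !codom_sum_inr.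
Qed.

Lemma triangle_free_sum :
  triangle_free G -> triangle_free H -> triangle_free graph_sum.
Proof.
move=> tfG tfH [x|x] [y|y] [z|z] [] //= xy yz xz; first exact: (tfG x y z).
exact: (tfH x y z).
Qed.

Lemma max_degree_sum :
  max_degree graph_sum = maxn (max_degree G) (max_degree H).
Proof.
rewrite /max_degree big_sumType; congr maxn; apply: eq_bigr => x _.
  exact: degree_sum_inl.
exact: degree_sum_inr.
Qed.

Lemma card_edges_sum : #|edges graph_sum| = #|edges G| + #|edges H|.
Proof.
apply/eqP; rewrite -(eqn_pmul2l (isT : 0 < 2)) mulnDr -!handshake big_sumType.
apply/eqP; congr (_ + _); apply: eq_bigr => x _; first exact: degree_sum_inl.
exact: degree_sum_inr.
Qed.

Lemma leq_matching_number_sum :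
  matching_number graph_sum <= matching_number G + matching_number H.
Proof.
apply/bigmax_leqP => M mM.
have leG := leq_card_matching_codom sum_inl_inj sum_inl_mono mM.
have leH := leq_card_matching_codom sum_inr_inj sum_inr_mono mM.
apply: leq_trans (leq_add leG leH); apply: leq_trans (leq_card_setU _ _).
apply/subset_leq_card/subsetP => e eM; rewrite !inE eM /=.
have /edgesP[[x|x] [[y|y] [// _ ->]]] := matching_edge mM eM;
  apply/orP; [left|right].
  by apply/subsetP => a /set2P[] ->; rewrite codom_sum_inl.
by apply/subsetP => a /set2P[] ->; rewrite codom_sum_inr.
Qed.

End GraphSum.

Section Star.
Variable d : nat.

Definition star_adj : rel (option 'I_d) :=
  fun x y => (x == None) != (y == None).

Lemma star_adj_sym : symmetric star_adj.
Proof. by move=> [x|] [y|]. Qed.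

Lemma star_adj_irr : irreflexive star_adj.
Proof. by move=> [x|]. Qed.

Definition star : sgraph := SGraph star_adj_sym star_adj_irr.
Let center : star := None.

Lemma triangle_free_star : triangle_free star.
Proof. by move=> [x|] [y|] [z|] []. Qed.

Lemma degree_star_center : degree center = d.
Proof.
rewrite -[RHS]card_ord -(card_imset _ Some_inj); apply: eq_card => x.
rewrite inE; case: x => [i|]; first by rewrite imset_f.
by apply/esym/imsetP => -[].
Qed.

Lemma vertex_cover_star : vertex_cover [set center].
Proof. by move=> [x|] [y|] //; rewrite !inE eqxx ?orbT. Qed.

Lemma leq_max_degree_star : 0 < d -> max_degree star <= d.
Proof.
move=> d0; apply/bigmax_leqP => -[i|] _; last by rewrite degree_star_center.
rewrite (leq_trans _ d0) // -(cards1 center) subset_leq_card //.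
by apply/subsetP => -[j|]; rewrite !inE.
Qed.

Lemma card_edges_star : #|edges star| = d.
Proof.
rewrite -degree_star_center degree_edges; apply: eq_card => e.
rewrite inE andb_idr // => /(vertex_cover_edge vertex_cover_star)/card_gt0P[x].
by rewrite !inE => /andP[/eqP ->].
Qed.

Lemma leq_matching_number_star : matching_number star <= 1.
Proof.
rewrite -(cards1 center).
exact/leq_matching_number_vertex_cover/vertex_cover_star.
Qed.

End Star.

Definition attainable (d m N : nat) : Prop :=
  exists G : sgraph,
    [/\ triangle_free G, max_degree G <= d, matching_number G <= m
      & #|edges G| = N].

Lemma attainable_add_stars d m N k :
  0 < d -> attainable d m N -> attainable d (m + k) (N + d * k).
Proof.
move=> d0 attN; elim: k => [|k [G [tfG DG nuG eG]]].
  by rewrite muln0 !addn0.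
exists (graph_sum G (star d)); split.
- exact: triangle_free_sum tfG (@triangle_free_star d).
- by rewrite max_degree_sum geq_max DG leq_max_degree_star.
- rewrite addnS -addn1 (leq_trans (leq_matching_number_sum _ _)) //.
  by rewrite leq_add // leq_matching_number_star.
- by rewrite card_edges_sum eG card_edges_star mulnSr addnA.
Qed.

Lemma card_factor_critical (G : sgraph) :
  factor_critical G -> 0 < #|G| -> #|G| = (2 * matching_number G).+1.
Proof.
move=> fc /card_gt0P[v _]; have [M /andP[mM /eqP covM]] := fc v.
have := card_cover_matching mM; rewrite covM cardsT => cardGv.
have := leq_trans (leq_matching_number mM) (leq_matching_number_del_vertex v).
have := leq_double_matching_number G; rewrite (card_del_vertex v) cardGv.
by move: #|M| (matching_number G) => mu nu; lia.
Qed.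

Lemma card_edges_regular (G : sgraph) d :
  regular G d -> 2 * #|edges G| = #|G| * d.
Proof. by move=> reg; rewrite -handshake -sum_nat_const; apply: eq_bigr. Qed.

Lemma card_edges_almost_regular (G : sgraph) d :
  0 < d -> almost_regular G d -> (2 * #|edges G|).+1 = #|G| * d.
Proof.
move=> d0 [v degv degw]; rewrite -handshake (bigD1 v) //= degv -addSn prednK //.
by rewrite -sum_nat_const [RHS](bigD1 v) //=; congr (_ + _); apply: eq_bigr.
Qed.

Lemma leq_max_degree_regular (G : sgraph) d : regular G d -> max_degree G <= d.
Proof. by move=> reg; apply/bigmax_leqP => v _; rewrite reg. Qed.

Lemma leq_max_degree_almost_regular (G : sgraph) d :
  almost_regular G d -> max_degree G <= d.
Proof.
case=> v degv degw; apply/bigmax_leqP => w _.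
by have [->|/degw ->] := eqVneq w v; rewrite ?degv ?leq_pred.
Qed.

Lemma attainable_Z d z : is_Z d z -> attainable d z (d * z + d %/ 2).
Proof.
case=> [[z0 [G [tf fc nuG reg]]] _].
have cardG : #|G| = (2 * z).+1.
  rewrite -nuG card_factor_critical //.
  by apply: leq_trans (leq_double_matching_number G); rewrite nuG muln_gt0.
have [DG eG] : max_degree G <= d /\ #|edges G| = d * z + d %/ 2.
  case: ifP reg => [odd_d|even_d] reg; split.
  - exact: leq_max_degree_almost_regular.
  - have := card_edges_almost_regular (odd_gt0 odd_d) reg.
    by rewrite cardG; move: #|_| => E; nia.
  - exact: leq_max_degree_regular.
  - have := card_edges_regular reg.
    by rewrite cardG; move: #|_| => E; nia.
by exists G; rewrite nuG.
Qed.

Theorem theorem5 (d m z : nat) (hd : 2 <= d) (hz : is_Z d z)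
    (hzm : z <= m) (hm : m < 2 * d) :
  is_f_triangle d m (d * m + d %/ 2).
Proof.
split=> [|_ [G [tf Dd nu <-]]].
  have := attainable_add_stars (m - z) (ltnW hd) (attainable_Z hz).
  by rewrite addnAC -mulnDr subnKC.
apply: leq_trans (leq_card_edges_triangle_free tf Dd) _.
exact: leq_trans (leq_edge_bound d nu) (leq_edge_bound_small hm).
Qed.
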